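(* Consider, on a single element with nodes $j=0,\ldots,N$, the split-form DG spectral element semi-discretization $$ m_j \dot{\mathbf u}^{\mathrm{DG}}_j + \sum_{k=0}^N S_{jk}\left(\mathbf f^{*}_{(j,k)} + \mathbf\Phi^{\star}_{(j,k)}\right) - \delta_{j0}\left(\hat{\mathbf f}_{(0,L)} + \mathbf\Phi^{\Diamond}_{(0,L)}\right) + \delta_{jN}\left(\hat{\mathbf f}_{(N,R)} + \mathbf\Phi^{\Diamond}_{(N,R)}\right) = \mathbf 0,\qquad j=0,\ldots,N. \quad (\ast) $$ Suppose the volume numerical non-conservative term can be written as the product of a local contribution and a jump term, $$ \mathbf\Phi^{\star}_{(j,k)} = \mathbf\Phi^{\mathrm{loc}}_j \circ \mathbf\Phi^{\mathrm{jump}}_{(j,k)},\qquad j,k=0,\ldots,N, $$ where $\mathbf\Phi^{\mathrm{loc}}_j = \mathbf\Phi^{\mathrm{loc}}(\mathbf u_j)$ depends only on quantities local to node $j$, and $\mathbf\Phi^{\mathrm{jump}}_{(j,k)} = -\mathbf\Phi^{\mathrm{jump}}_{(k,j)}$ is the jump of some nodal quantity $\mathbf r$ between nodes $j$ and $k$, i.e. $\mathbf\Phi^{\mathrm{jump}}_{(j,k)} = \mathbf r_k - \mathbf r_j$. Then $(\ast)$ can be rewritten as the flux-differencing formula $$ m_j \dot{\mathbf u}^{\mathrm{DG}}_j = \mathbf\Gamma^{\mathrm{DG}}_{(j,j-1)} - \mathbf\Gamma^{\mathrm{DG}}_{(j,j+1)},\qquad j=0,\ldots,N, $$ where the indices $-1$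 and $N+1$ refer to the outer states across the left and right element boundaries, respectively, and the staggered fluxes are defined by $$ \mathbf\Gamma^{\mathrm{DG}}_{(0,-1)} = \hat{\mathbf f}_{(0,L)} + \mathbf\Phi^{\Diamond}_{(0,L)},\qquad \mathbf\Gamma^{\mathrm{DG}}_{(N,N+1)} = \hat{\mathbf f}_{(N,R)} + \mathbf\Phi^{\Diamond}_{(N,R)}, $$ and, for all pairs of adjacent nodes $(j,k)=(j,j\pm1)$ other than $(0,-1)$ and $(N,N+1)$, $$ \mathbf\Gamma^{\mathrm{DG}}_{(j,k)} = \sum_{l=0}^{\min(j,k)}\sum_{m=0}^N S_{lm}\,\mathbf f^{*}_{(l,m)} + \mathbf\Phi^{\mathrm{loc}}_j\circ\sum_{l=0}^{\min(j,k)}\sum_{m=0}^N S_{lm}\,\mathbf\Phi^{\mathrm{jump}}_{(l,m)} + 2\,\mathbf\Phi^{\mathrm{loc}}_j\circ\mathbf\Phi^{\mathrm{jump}}_{(j,0)}. $$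
   Context: All bold quantities (states, fluxes, non-conservative terms, $\mathbf r$) are vectors in $\mathbb R^n$, where $n$ is the number of equations of the system; $\circ$ is the Hadamard (element-wise) product and $\delta_{ij}$ the Kronecker delta. Let $N\ge 1$ be the polynomial degree, $\xi_0=-1<\cdots<\xi_N=1$ the Legendre–Gauss–Lobatto (LGL) nodes on $[-1,1]$, $\omega_j>0$ the LGL quadrature weights, and $\ell_k$ the Lagrange polynomials of degree $N$ on these nodes. The mass matrix entries are $m_j = J\omega_j$, where $J>0$ is the Jacobian determinant of the map from $[-1,1]$ to the element. Define the matrices (indices from $0$ to $N$) $$Q_{jk}=\omega_j\,\ell_k'(\xi_j),\qquad B=\mathrm{diag}(-1,0,\ldots,0,1),\qquad S = 2Q-B .$$ They satisfy the summation-by-parts property $Q+Q^T=B$ (so $S=Q-Q^T$ is skew-symmetric), as well as $\sum_{k}Q_{jk}=0$, $\sum_k B_{jk}=\delta_{jN}-\delta_{j0}$, $\sum_{j}Q_{jk}=\delta_{kN}-\delta_{k0}$ and $\sum_j B_{jk}=\delta_{kN}-\delta_{k0}$. The nodal states on the element are $\mathbf u_0,\ldots,\mathbf u_N$; $\dot{\mathbf u}^{\mathrm{DG}}_j$ denotes the time derivative of the state at node $j$ defined by the scheme. $\mathbf f^{*}_{(j,k)}$ is a symmetric two-point volume flux, $\mathbf f^{*}_{(j,k)}=\mathbf f^{*}_{(k,j)}$, evaluated between nodes $j$ and $k$. $\mathbf\Phi^{\star}_{(j,k)}$ is a (generally non-symmetric) two-point discretization of the non-conservative term. $\hat{\mathbf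 f}_{(0,L)},\hat{\mathbf f}_{(N,R)}$ are numerical surface fluxes and $\mathbf\Phi^{\Diamond}_{(0,L)},\mathbf\Phi^{\Diamond}_{(N,R)}$ numerical non-conservative surface terms at the left and right element boundaries; they are arbitrary given vectors depending on the boundary node state and on the neighboring element's outer state ($L$ or $R$). *)

(* Defs.v *)
From mathcomp Require Import all_boot all_order all_algebra.
From mathcomp Require Import all_classical all_reals all_analysis.
Set Implicit Arguments.
Unset Strict Implicit.
Unset Printing Implicit Defensive.
Import Order.TTheory GRing.Theory Num.Theory.
Local Open Scope ring_scope.

Definition hadamard (R : realType) (n : nat) (x y : 'cV[R]_n) : 'cV[R]_n :=
  map2_mx *%R x y.

(* Rodrigues' formula. *)
Definition legendre (R : realType) (N : nat) : {poly R} :=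
  (2%:R ^+ N * N`!%:R)^-1 *: (('X ^+ 2 - 1) ^+ N)^`(N).

(* The Legendre-Gauss-Lobatto nodes of degree N are the two endpoints of
   [-1, 1] together with the N - 1 zeros of P_N'; since the nodes are strictly
   increasing, this predicate determines them uniquely. *)
Definition lgl_nodes (R : realType) (N : nat) (xi : 'I_N.+1 -> R) : Prop :=
  [/\ forall i j : 'I_N.+1, (i < j)%N -> xi i < xi j,
      xi ord0 = -1,
      xi ord_max = 1
    & forall i : 'I_N.+1, i != ord0 -> i != ord_max ->
        root (legendre R N)^`() (xi i)].

(* The lagrange basis of qpoly.v samples a map nat -> R and its theory needs
   that map to be injective on all of nat; here the nodes form a finite family. *)
Definition lagrange_poly (R : realType) (N : nat) (xi : 'I_N.+1 -> R)
    (k : 'I_N.+1) : {poly R} :=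
  \prod_(i < N.+1 | i != k) ((xi k - xi i)^-1 *: ('X - (xi i)%:P)).

(* Interpolatory weights, omega_j = int_{-1}^{1} l_j. *)
Definition lgl_weight (R : realType) (N : nat) (xi : 'I_N.+1 -> R)
    (j : 'I_N.+1) : R :=
  (\int[lebesgue_measure]_(x in `[(-1)%R, 1%R]%classic)
     (lagrange_poly xi j).[x])%R.

Definition mass (R : realType) (N : nat) (J : R) (xi : 'I_N.+1 -> R)
    (j : 'I_N.+1) : R :=
  J * lgl_weight xi j.

Definition Qmx (R : realType) (N : nat) (xi : 'I_N.+1 -> R) : 'M[R]_N.+1 :=
  \matrix_(j, k) (lgl_weight xi j * (lagrange_poly xi k)^`().[xi j]).

(* diag(-1, 0, ..., 0, 1), for N >= 1. *)
Definition Bmx (R : realType) (N : nat) : 'M[R]_N.+1 :=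
  diag_mx (\row_j ((j == ord_max)%:R - (j == ord0)%:R)).

Definition Smx (R : realType) (N : nat) (xi : 'I_N.+1 -> R) : 'M[R]_N.+1 :=
  2%:R *: Qmx xi - Bmx R N.

(* The staggered flux Gamma_(j,k) between node j and its neighbour k = j -+ 1;
   k ranges over int because k = -1 and k = N + 1 stand for the outer states.
   gL and gR are the total numerical surface terms at the two boundaries. The
   values for k other than j - 1 and j + 1 are irrelevant. *)
Definition staggered_flux (R : realType) (N n : nat) (S : 'M[R]_N.+1)
    (fstar : 'I_N.+1 -> 'I_N.+1 -> 'cV[R]_n)
    (Philoc : 'I_N.+1 -> 'cV[R]_n)
    (Phijump : 'I_N.+1 -> 'I_N.+1 -> 'cV[R]_n)
    (gL gR : 'cV[R]_n) (j : 'I_N.+1) (k : int) : 'cV[R]_n :=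
  if (j == ord0) && (k == -1) then gL
  else if (j == ord_max) && (k == N.+1%:Z) then gR
  else
    \sum_(l < N.+1 | l%:Z <= Num.min j%:Z k) \sum_(m < N.+1)
        S l m *: fstar l m
    + hadamard (Philoc j)
        (\sum_(l < N.+1 | l%:Z <= Num.min j%:Z k) \sum_(m < N.+1)
            S l m *: Phijump l m)
    + 2%:R *: hadamard (Philoc j) (Phijump j ord0).

(* Main.v *)
Require Import Defs.
From HB Require Import structures.
From mathcomp Require Import all_boot all_order all_algebra.
From mathcomp Require Import all_classical all_reals all_analysis.
From mathcomp Require Import ring zify.
From mathcomp Require polyorder cauchyreals.
Set Implicit Arguments.
Unset Strict Implicit.
Unset Printing Implicit Defensive.
Import Order.TTheory GRing.Theory Num.Theory.
Import numFieldNormedType.Exports.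
Local Open Scope ring_scope.

(** The flux-differencing formula telescopes. Fix a node [j] and accumulate, over
    the rows [l] of some initial segment of nodes, the symmetric flux
    contributions plus the jump contributions multiplied by the local factor of
    node [j] ([cumulative_flux]). The fluxes Gamma_(j,j-1) and Gamma_(j,j+1)
    accumulate the rows [l < j] and [l <= j] with the same local factor, so their
    difference is the single row [j], that is, the volume term of the scheme at
    node [j] ([cumulative_flux_step]). This is the scheme, provided that the
    values which the accumulated fluxes would have at the two outer interfaces,
    where Gamma is replaced by the surface terms, are zero.

    At the left interface the sums are empty and the jump from node 0 to itself
    vanishes. At the right interface all rows are summed
    ([cumulative_flux_last]). There the symmetric flux drops out since S is
    skew-symmetric. Skewness and the row sums of S turn the double sum of
    [S l m (r m - r l)] into [2 (r N - r 0)], which is cancelled by the summand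
    [2 (r 0 - r N)]: this is the purpose of the last term in the definition of
    Gamma.

    The analytic content is thus the skew-symmetry of S = 2Q - B, i.e. the
    summation-by-parts identity Q + Q^T = B ([Qmx_sbp]). Entry (j,k) of its left
    side is the Lobatto quadrature of the derivative of l_j l_k, a polynomial of
    degree at most 2N - 1, and its right side is the integral of that derivative
    over [-1, 1]. So it suffices that the quadrature is exact up to degree
    2N - 1 ([lgl_quadrature_exact]). The interpolatory weights make it exact
    up to degree N, and division by the nodal polynomial W, a multiple of
    (X^2 - 1) P_N', leaves the integral of q W with deg q <= N - 2. Integration
    by parts, in which the factor X^2 - 1 kills the boundary terms, reduces that
    integral to the orthogonality of P_N to polynomials of lower degree, which
    in turn is repeated integration by parts in Rodrigues' formula. *)

(** * Integrals of polynomials over [-1, 1] *)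

Definition poly_int (R : realType) (p : {poly R}) : R :=
  (\int[lebesgue_measure]_(x in `[(-1)%R, 1%R]%classic) p.[x])%R.

Lemma horner_integrable (R : realType) (p : {poly R}) :
  (@lebesgue_measure R).-integrable `[(-1)%R, 1%R]%classic
    (EFin \o horner p).
Proof.
apply: continuous_compact_integrable; first exact: segment_compact.
by apply: continuous_subspaceT => x; exact: continuous_horner.
Qed.

Lemma poly_int_is_linear (R : realType) :
  linear_for *%R (@poly_int R).
Proof.
move=> c p q; rewrite /poly_int -RintegralZl //; last exact: horner_integrable.
rewrite -RintegralD//; try exact: horner_integrable.
  by apply: eq_Rintegral => x _; rewrite !hornerE.
have -> : (fun x : R => c * p.[x]) = horner (c *: p).
  by apply/funext => x; rewrite hornerZ.
exact: horner_integrable.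
Qed.

HB.instance Definition _ (R : realType) :=
  GRing.isLinear.Build R {poly R} R *%R (@poly_int R) (@poly_int_is_linear R).

Lemma poly_int_deriv (R : realType) (p : {poly R}) :
  poly_int p^`() = p.[1] - p.[-1].
Proof.
rewrite /poly_int /Rintegral (@continuous_FTC2 _ _ (horner p)) //.
- by apply: continuous_subspaceT => x; exact: continuous_horner.
- split.
  + by move=> x _; exact: derivable_horner.
  + by apply: cvg_at_right_filter; exact: continuous_horner.
  + by apply: cvg_at_left_filter; exact: continuous_horner.
- by move=> x _; rewrite -derivE.
Qed.

Lemma poly_int_by_parts (R : realType) (p q : {poly R}) :
  root p 1 -> root p (-1) -> poly_int (p^`() * q) = - poly_int (p * q^`()).
Proof.
move=> /rootP p1 /rootP pN1; apply/eqP; rewrite -addr_eq0 -linearD /= -derivM.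
by rewrite poly_int_deriv !hornerM p1 pN1 !mul0r subrr.
Qed.

(** Each differentiation lowers the multiplicity of a root by at most one; the
    cofactor [q] is arbitrary because the induction changes it. *)
Lemma root_derivn (R : comNzRingType) (a : R) (q : {poly R}) (n m : nat) :
  (m < n)%N -> root (q * ('X - a%:P) ^+ n)^`(m) a.
Proof.
elim: m n q => [|m IHm] [|n] q // lt_mn.
  by rewrite derivn0 exprS mulrCA rootE hornerM hornerXsubC subrr mul0r.
have -> : (q * ('X - a%:P) ^+ n.+1)^`(m.+1) =
    ((q^`() * ('X - a%:P) + q *+ n.+1) * ('X - a%:P) ^+ n)^`(m).
  rewrite derivSn; congr (_^`(m)).
  rewrite derivM deriv_exp derivXsubC mul1r mulrDl -mulrA -exprS.
  by rewrite mulrnAl mulrnAr.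
exact: IHm.
Qed.

(** * Legendre polynomials *)

(** Each of the [k] integrations by parts moves one derivative from [w] to [q],
    with boundary terms killed by the zeros of [w], until [q] has been
    differentiated to zero. *)
Lemma poly_int_derivn (R : realType) (w q : {poly R}) (k : nat) :
  (forall m, (m < k)%N -> root w^`(m) 1 /\ root w^`(m) (-1)) ->
  (size q <= k)%N -> poly_int (w^`(k) * q) = 0.
Proof.
elim: k q => [|k IHk] q w_root size_q.
  by move: size_q; rewrite leqn0 size_poly_eq0 => /eqP->; rewrite mulr0 linear0.
have [w1 wN1] := w_root k (ltnSn k).
rewrite derivnS poly_int_by_parts // IHk ?oppr0 //.
  by move=> m lt_mk; apply: w_root; rewrite ltnS ltnW.
by rewrite polyorder.size_deriv; case: (size q) size_q.
Qed.

(** Rodrigues' formula exhibits P_N as the N-th derivative of a polynomial with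
    N-fold zeros at both endpoints. *)
Lemma legendre_orthogonal (R : realType) (N : nat) (q : {poly R}) :
  (size q <= N)%N -> poly_int (legendre R N * q) = 0.
Proof.
move=> size_q; rewrite /legendre -scalerAl linearZ /= poly_int_derivn ?mulr0 //.
have factored : ('X ^+ 2 - 1 : {poly R}) ^+ N =
    ('X - (-1)%:P) ^+ N * ('X - 1%:P) ^+ N.
  by rewrite -exprMn; congr (_ ^+ N); rewrite polyCN; ring.
move=> m lt_mN; split; first by rewrite factored root_derivn.
by rewrite factored mulrC root_derivn.
Qed.

Lemma size_X2sub1 (R : realType) : size ('X ^+ 2 - 1 : {poly R}) = 3%N.
Proof. exact: size_XnsubC. Qed.

Lemma size_legendre (R : realType) (N : nat) : size (legendre R N) = N.+1.
Proof.
rewrite size_scale; last first.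
  by rewrite invr_neq0 // mulf_neq0 ?expf_neq0 // pnatr_eq0 -?lt0n ?fact_gt0.
rewrite cauchyreals.size_derivn.
have := size_exp ('X ^+ 2 - 1 : {poly R}) N; rewrite size_X2sub1 /=.
have : ('X ^+ 2 - 1 : {poly R}) ^+ N != 0.
  by rewrite expf_neq0 // -size_poly_gt0 size_X2sub1.
rewrite -size_poly_gt0; case: (size _) => //= s _ ->.
by rewrite mul2n -addnn -addSn addnK.
Qed.

(** * Lobatto nodes and quadrature *)

Section Nodes.
Variables (R : realType) (N : nat) (xi : 'I_N.+1 -> R).

Lemma lgl_nodes_inj : lgl_nodes xi -> injective xi.
Proof.
case=> xi_incr _ _ _ i j eq_ij; apply/val_inj.
by case: (ltngtP i j) => // /xi_incr; rewrite eq_ij ltxx.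
Qed.

Lemma lagrange_poly_node (k i : 'I_N.+1) : injective xi ->
  (lagrange_poly xi k).[xi i] = (i == k)%:R.
Proof.
move=> xi_inj; rewrite /lagrange_poly horner_prod.
have [->|neq_ik] := eqVneq i k.
  rewrite big1 // => l neq_lk; rewrite hornerZ hornerXsubC mulVf //.
  by rewrite subr_eq0 (inj_eq xi_inj) eq_sym.
by rewrite (bigD1 i) //= hornerZ hornerXsubC subrr mulr0 mul0r.
Qed.

Lemma size_lagrange_poly (k : 'I_N.+1) : (size (lagrange_poly xi k) <= N.+1)%N.
Proof.
rewrite /lagrange_poly scaler_prod (leq_trans (size_scale_leq _ _)) //.
rewrite -big_filter size_prod_XsubC.
have [e _ _ [_ ->]] := big_enumP.
by have := cardC1 k; rewrite card_ord => ->.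
Qed.

Lemma node_poly_eq0 (p : {poly R}) : injective xi ->
  (size p <= N.+1)%N -> (forall i, p.[xi i] = 0) -> p = 0.
Proof.
move=> xi_inj size_p p_node.
apply: (@roots_geq_poly_eq0 _ p (codom xi)).
- by apply/allP => _ /codomP[i ->]; apply/rootP.
- by rewrite codomE map_inj_uniq ?enum_uniq.
- by rewrite size_codom card_ord.
Qed.

Lemma lagrange_interpolation (p : {poly R}) : injective xi ->
  (size p <= N.+1)%N -> p = \sum_j p.[xi j] *: lagrange_poly xi j.
Proof.
move=> xi_inj size_p; apply/eqP; rewrite -subr_eq0; apply/eqP.
apply: node_poly_eq0 => //.
  rewrite (leq_trans (size_polyD _ _)) // geq_max size_p size_polyN.
  rewrite (leq_trans (size_sum _ _ _)) //; apply/bigmax_leqP => j _.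
  by rewrite (leq_trans (size_scale_leq _ _)) ?size_lagrange_poly.
move=> i; rewrite hornerD hornerN horner_sum (bigD1 i) //= big1 => [|j neq_ji].
  by rewrite hornerZ lagrange_poly_node // eqxx mulr1 addr0 subrr.
by rewrite hornerZ lagrange_poly_node // eq_sym (negPf neq_ji) mulr0.
Qed.

Definition nodal_poly : {poly R} := \prod_i ('X - (xi i)%:P).

(** Both sides have degree N + 1, and the N + 1 distinct nodes are roots of the
    right side. *)
Lemma nodal_poly_lgl : (0 < N)%N -> lgl_nodes xi ->
  exists c, nodal_poly = c *: (('X ^+ 2 - 1) * (legendre R N)^`()).
Proof.
move=> N_gt0 xi_lgl; have xi_inj := lgl_nodes_inj xi_lgl.
have [_ xi0 xiN xi_root] := xi_lgl.
set w := _ * _.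
have size_dP : size (legendre R N)^`() = N.
  by rewrite polyorder.size_deriv size_legendre.
have size_w : size w = N.+2.
  rewrite size_mul ?size_X2sub1 ?size_dP // -size_poly_gt0 ?size_X2sub1 //.
  by rewrite size_dP.
have w_neq0 : w != 0 by rewrite -size_poly_gt0 size_w.
have w_nodal : w = lead_coef w *: nodal_poly.
  rewrite {1}(@all_roots_prod_XsubC _ w (codom xi)).
  - by rewrite codomE big_map big_enum.
  - by rewrite size_codom card_ord.
  - apply/allP => _ /codomP[i ->]; rewrite rootM.
    have [->|neq_i0] := eqVneq i ord0.
      by rewrite xi0 rootE !hornerE sqrrN expr1n subrr eqxx.
    have [->|neq_iN] := eqVneq i ord_max.
      by rewrite xiN rootE !hornerE expr1n subrr eqxx.
    by rewrite xi_root ?orbT.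
  - by rewrite uniq_rootsE codomE map_inj_uniq ?enum_uniq.
exists (lead_coef w)^-1.
by rewrite {2}w_nodal scalerA mulVf ?scale1r // lead_coef_eq0.
Qed.

(** With P_N' integrated by parts against q (X^2 - 1), the polynomial tested
    against P_N is the derivative of q (X^2 - 1), of degree one more than q: this
    is where the bound on the degree of q comes from. *)
Lemma nodal_poly_orthogonal (q : {poly R}) : (0 < N)%N -> lgl_nodes xi ->
  (size q < N)%N -> poly_int (q * nodal_poly) = 0.
Proof.
move=> N_gt0 xi_lgl size_q; have [c ->] := nodal_poly_lgl N_gt0 xi_lgl.
rewrite -scalerAr linearZ /= mulrA.
set v := q * _.
(* [v] carries the factor X^2 - 1, so its boundary terms vanish. *)
have v_root : root v 1 /\ root v (-1).
  by split; rewrite rootM !rootE !hornerE ?sqrrN expr1n subrr eqxx orbT.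
have -> : poly_int (v * (legendre R N)^`()) =
    - poly_int (legendre R N * v^`()).
  case: v_root => v1 vN1.
  by rewrite [legendre R N * _]mulrC poly_int_by_parts // opprK.
rewrite legendre_orthogonal ?oppr0 ?mulr0 //.
rewrite polyorder.size_deriv -subn1 leq_subLR add1n.
rewrite (leq_trans (size_polyMleq _ _)) // size_X2sub1 addn3 /=.
by rewrite !ltnS.
Qed.

(** Modulo the nodal polynomial, [p] reduces to its interpolant, for which the
    quadrature is exact by the choice of the weights; the multiple of the nodal
    polynomial that is discarded has integral zero and vanishes at the nodes. *)
Lemma lgl_quadrature_exact (p : {poly R}) : (0 < N)%N -> lgl_nodes xi ->
  (size p <= N.*2)%N -> poly_int p = \sum_j lgl_weight xi j * p.[xi j].
Proof.
move=> N_gt0 xi_lgl size_p; have xi_inj := lgl_nodes_inj xi_lgl.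
have size_nodal : size nodal_poly = N.+2.
  rewrite /nodal_poly size_prod_XsubC -sum1_size.
  by rewrite big_const_ord iter_addn_0 mul1n.
have nodal_neq0 : nodal_poly != 0 by rewrite -size_poly_gt0 size_nodal.
have nodal_node j : nodal_poly.[xi j] = 0.
  by rewrite /nodal_poly (bigD1 j) //= hornerM hornerXsubC subrr mul0r.
have size_rem : (size (p %% nodal_poly)%R <= N.+1)%N.
  by rewrite -ltnS -size_nodal ltn_modp.
rewrite {1}(divp_eq p nodal_poly) linearD /= nodal_poly_orthogonal //; last first.
  by rewrite size_divp // size_nodal /=; move: (size p) size_p => s; lia.
rewrite add0r {1}(lagrange_interpolation xi_inj size_rem) linear_sum /=.
apply: eq_bigr => j _; rewrite linearZ /= mulrC; congr (_ * _).
by rewrite {2}(divp_eq p nodal_poly) hornerD hornerM nodal_node mulr0 add0r.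
Qed.

(** * Summation by parts *)

Hypotheses (N_gt0 : (0 < N)%N) (xi_lgl : lgl_nodes xi).

(** An entry of the left side is the quadrature sum for the derivative of a
    product of two Lagrange polynomials, collapsed by their nodal values. *)
Lemma Qmx_sbp : Qmx xi + (Qmx xi)^T = Bmx R N.
Proof.
have xi_inj := lgl_nodes_inj xi_lgl; have [_ xi0 xiN _] := xi_lgl.
apply/matrixP => j k; rewrite !mxE.
have -> : lgl_weight xi j * (lagrange_poly xi k)^`().[xi j] +
    lgl_weight xi k * (lagrange_poly xi j)^`().[xi k] =
    poly_int (lagrange_poly xi j * lagrange_poly xi k)^`().
  rewrite lgl_quadrature_exact //; last first.
    rewrite polyorder.size_deriv.
    move: (size_lagrange_poly j) (size_lagrange_poly k).
    move: (size_polyMleq (lagrange_poly xi j) (lagrange_poly xi k)).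
    by move: (size _) (size _) (size _) => a b c; lia.
  rewrite derivM; under eq_bigr do rewrite hornerD !hornerM mulrDr.
  rewrite big_split /= addrC; congr (_ + _).
    rewrite (bigD1 j) //= big1 ?addr0 => [|i /negPf neq_ij].
      by rewrite lagrange_poly_node // eqxx mul1r.
    by rewrite lagrange_poly_node // neq_ij mul0r mulr0.
  rewrite (bigD1 k) //= big1 ?addr0 => [|i /negPf neq_ik].
    by rewrite [_.[_] * _]mulrC lagrange_poly_node // eqxx mul1r.
  by rewrite [_.[_] * _]mulrC lagrange_poly_node // neq_ik mul0r mulr0.
have endpoint a : (lagrange_poly xi j * lagrange_poly xi k).[xi a] =
    (a == j)%:R * (a == k)%:R.
  by rewrite hornerM !lagrange_poly_node.
rewrite poly_int_deriv -{1}xiN -xi0 !endpoint.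
have [<-|neq_jk] := eqVneq j k.
  by rewrite mulr1n -!natrM !mulnb !andbb !(eq_sym j).
rewrite mulr0n.
have off a : (a == j)%:R * (a == k)%:R = 0 :> R.
  by case: eqP => [->|_]; rewrite ?(negPf neq_jk) ?mulr0 ?mul0r.
by rewrite !off subrr.
Qed.

(** The rows of Q differentiate the constant 1, the sum of the Lagrange basis. *)
Lemma Qmx_row_sum j : \sum_k Qmx xi j k = 0.
Proof.
have xi_inj := lgl_nodes_inj xi_lgl.
have size_1 : (size (1%R : {poly R}) <= N.+1)%N by rewrite size_poly1.
have sum1 := lagrange_interpolation xi_inj size_1.
under eq_bigr do rewrite mxE.
rewrite -mulr_sumr -horner_sum -linear_sum /=.
have -> : \sum_k lagrange_poly xi k = 1.
  by rewrite [RHS]sum1; apply: eq_bigr => k _; rewrite hornerC scale1r.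
by rewrite derivC horner0 mulr0.
Qed.

Lemma Bmx_row_sum (j : 'I_N.+1) :
  \sum_k Bmx R N j k = (j == ord_max)%:R - (j == ord0)%:R.
Proof.
rewrite (bigD1 j) //= big1 ?addr0 => [|k /negPf neq_kj].
  by rewrite !mxE eqxx mulr1n.
by rewrite !mxE [j == k]eq_sym neq_kj mulr0n.
Qed.

Lemma Smx_skew : (Smx xi)^T = - Smx xi.
Proof.
have := Qmx_sbp; rewrite /Smx linearB linearZ /= tr_diag_mx -/(Bmx R N) => <-.
apply/matrixP => j k; rewrite !mxE; ring.
Qed.

Lemma Smx_row_sum j :
  \sum_k Smx xi j k = (j == ord0)%:R - (j == ord_max)%:R.
Proof.
have -> : \sum_k Smx xi j k = 2 * \sum_k Qmx xi j k - \sum_k Bmx R N j k.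
  by rewrite mulr_sumr -sumrB; apply: eq_bigr => k _; rewrite 3!mxE [in LHS]mxE.
by rewrite Qmx_row_sum Bmx_row_sum mulr0 sub0r opprB.
Qed.

End Nodes.

(** * Double sums against a skew-symmetric matrix *)

Section SkewSums.
Variables (R : numFieldType) (V : lmodType R) (I : finType) (S : I -> I -> R).
Hypothesis S_skew : forall l m, S l m = - S m l.

Lemma skew_sum_sym (f : I -> I -> V) :
  (forall l m, f l m = f m l) -> \sum_l \sum_m S l m *: f l m = 0.
Proof.
move=> f_sym; set T := \sum_l _.
have TN : T = - T.
  rewrite {1}/T exchange_big -sumrN; apply: eq_bigr => l _.
  by rewrite -sumrN; apply: eq_bigr => m _; rewrite S_skew f_sym scaleNr.
have : 2%:R *: T = 0 by rewrite scaler_nat mulr2n {1}TN addNr.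
by move/eqP; rewrite scaler_eq0 pnatr_eq0 /= => /eqP.
Qed.

(** Exchanging the two indices turns the [r m] part into a copy of the [r l]
    part, so that only the row sums of [S] matter. *)
Lemma skew_sum_diff (r : I -> V) :
  \sum_l \sum_m S l m *: (r m - r l) =
  - (2%:R *: \sum_l (\sum_m S l m) *: r l).
Proof.
set T := \sum_l (_ *: _).
have Tout : \sum_l \sum_m S l m *: r l = T.
  by apply: eq_bigr => l _; rewrite scaler_suml.
have Tin : \sum_l \sum_m S l m *: r m = - T.
  rewrite -Tout exchange_big -sumrN; apply: eq_bigr => l _.
  by rewrite -sumrN; apply: eq_bigr => m _; rewrite S_skew scaleNr.
under eq_bigr do (under eq_bigr do rewrite scalerBr; rewrite sumrB).
by rewrite sumrB Tin Tout -opprD scaler_nat mulr2n.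
Qed.
End SkewSums.

(** * Telescoping of the staggered fluxes *)

Lemma hadamard_is_linear (R : realType) (n : nat) (x : 'cV[R]_n) :
  linear (hadamard x).
Proof. by move=> c y z; apply/matrixP => i j; rewrite !mxE; ring. Qed.

HB.instance Definition _ (R : realType) (n : nat) (x : 'cV[R]_n) :=
  GRing.isLinear.Build R 'cV[R]_n 'cV[R]_n *:%R (hadamard x)
    (hadamard_is_linear x).

Section StaggeredFlux.
Variables (R : realType) (N n : nat) (S : 'M[R]_N.+1).
Variables (fstar : 'I_N.+1 -> 'I_N.+1 -> 'cV[R]_n).
Variables (Philoc : 'I_N.+1 -> 'cV[R]_n).
Variables (Phijump : 'I_N.+1 -> 'I_N.+1 -> 'cV[R]_n) (gL gR : 'cV[R]_n).

(** The local factor stays that of node [j] while the rows vary over [A]; this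
    is what lets Gamma_(j,j-1) and Gamma_(j,j+1) be compared even though
    Gamma_(j,j+1) and Gamma_(j+1,j) differ. *)
Definition cumulative_flux (j : 'I_N.+1) (A : pred 'I_N.+1) : 'cV[R]_n :=
  \sum_(l | A l) \sum_m S l m *: fstar l m
  + hadamard (Philoc j) (\sum_(l | A l) \sum_m S l m *: Phijump l m)
  + 2%:R *: hadamard (Philoc j) (Phijump j ord0).

Local Notation Gamma := (staggered_flux S fstar Philoc Phijump gL gR).

Lemma staggered_flux_prev (j : 'I_N.+1) :
  Gamma j (j%:Z - 1) =
  if j == ord0 then gL else cumulative_flux j (fun l => (l < j)%N).
Proof.
rewrite /staggered_flux; have [->//|j_neq0] := eqVneq j ord0.
have -> : (j%:Z - 1 == N.+1%:Z) = false by have := ltn_ord j; lia.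
rewrite andbF /cumulative_flux.
have below l : (l%:Z <= Num.min j%:Z (j%:Z - 1)) = (l < j)%N by lia.
by congr (_ + hadamard _ _ + _); apply: eq_bigl => l; rewrite below.
Qed.

Lemma staggered_flux_next (j : 'I_N.+1) :
  Gamma j (j%:Z + 1) =
  if j == ord_max then gR else cumulative_flux j (fun l => (l <= j)%N).
Proof.
rewrite /staggered_flux.
have -> : (j%:Z + 1 == -1) = false by lia.
rewrite andbF; have [->|_] := eqVneq j ord_max.
  by have -> : ((@ord_max N)%:Z + 1 == N.+1%:Z) = true by rewrite /=; lia.
have upto l : (l%:Z <= Num.min j%:Z (j%:Z + 1)) = (l <= j)%N by lia.
by congr (_ + hadamard _ _ + _); apply: eq_bigl => l; rewrite upto.
Qed.

Lemma cumulative_flux_step (j : 'I_N.+1) :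
  cumulative_flux j (fun l => (l <= j)%N)
  - cumulative_flux j (fun l => (l < j)%N) =
  \sum_m S j m *: (fstar j m + hadamard (Philoc j) (Phijump j m)).
Proof.
have split_sum (F : 'I_N.+1 -> 'cV[R]_n) :
    \sum_(l < N.+1 | (l <= j)%N) F l = F j + \sum_(l < N.+1 | (l < j)%N) F l.
  rewrite (bigD1 j) //=; congr (_ + _); apply: eq_bigl => l.
  by rewrite andbC -ltn_neqAle.
rewrite /cumulative_flux !split_sum linearD /= linear_sum /=.
under [X in _ + (X + _)]eq_bigr do rewrite linearZ /=.
under [RHS]eq_bigr do rewrite scalerDr.
rewrite big_split /=.
set a := \sum_m _; set b := \sum_m _.
by rewrite (addrACA a) -(addrA (a + b)) addrK.
Qed.

Lemma cumulative_flux_first : Phijump ord0 ord0 = 0 ->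
  cumulative_flux ord0 (fun l => (l < @ord0 N)%N) = 0.
Proof.
by move=> jump0; rewrite /cumulative_flux jump0 !big_pred0 // !linear0 !addr0.
Qed.

(** The full double sum of jumps equals [2 (r N - r 0)], and the correction term
    is [2 (r 0 - r N)] because it takes the jump from the last node to the
    first. *)
Lemma cumulative_flux_last (r : 'I_N.+1 -> 'cV[R]_n) :
  (forall l m, S l m = - S m l) ->
  (forall l, \sum_m S l m = (l == ord0)%:R - (l == ord_max)%:R) ->
  (forall l m, fstar l m = fstar m l) ->
  (forall l m, Phijump l m = r m - r l) ->
  cumulative_flux ord_max (fun l => (l <= @ord_max N)%N) = 0.
Proof.
move=> S_skew S_row f_sym jumpE; rewrite /cumulative_flux.
have all_nodes (F : 'I_N.+1 -> 'cV[R]_n) :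
    \sum_(l < N.+1 | (l <= @ord_max N)%N) F l = \sum_l F l.
  by apply: eq_bigl => l; rewrite -ltnS ltn_ord.
rewrite !all_nodes skew_sum_sym // add0r -linearZ -linearD /=.
under eq_bigr do under eq_bigr do rewrite jumpE.
rewrite skew_sum_diff // jumpE -scalerN -scalerDr.
have -> : \sum_l (\sum_m S l m) *: r l = r ord0 - r ord_max.
  under eq_bigr do rewrite S_row scalerBl.
  rewrite sumrB.
  have pick a : \sum_l (l == a)%:R *: r l = r a.
    rewrite (bigD1 a) //= eqxx scale1r big1 ?addr0 // => l /negPf->.
    by rewrite scale0r.
  by rewrite !pick.
by rewrite addNr scaler0 linear0.
Qed.

End StaggeredFlux.

Theorem proposition1 (R : realType) (n N : nat) (N_ge1 : (1 <= N)%N)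
    (xi : 'I_N.+1 -> R) (xi_lgl : lgl_nodes xi)
    (J : R) (J_gt0 : 0 < J)
    (u : 'I_N.+1 -> 'cV[R]_n)
    (fstar : 'I_N.+1 -> 'I_N.+1 -> 'cV[R]_n)
    (fstar_sym : forall j k, fstar j k = fstar k j)
    (Phistar : 'I_N.+1 -> 'I_N.+1 -> 'cV[R]_n)
    (Philoc : 'cV[R]_n -> 'cV[R]_n)
    (Phijump : 'I_N.+1 -> 'I_N.+1 -> 'cV[R]_n)
    (r : 'I_N.+1 -> 'cV[R]_n)
    (Phistar_split : forall j k,
       Phistar j k = hadamard (Philoc (u j)) (Phijump j k))
    (Phijump_anti : forall j k, Phijump j k = - Phijump k j)
    (Phijump_r : forall j k, Phijump j k = r k - r j)
    (fhat0L PhiD0L fhatNR PhiDNR : 'cV[R]_n)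
    (udot : 'I_N.+1 -> 'cV[R]_n) :
  let S := Smx xi in
  let Gamma := staggered_flux S fstar (fun j => Philoc (u j)) Phijump
                 (fhat0L + PhiD0L) (fhatNR + PhiDNR) in
  forall j : 'I_N.+1,
    mass J xi j *: udot j
      + \sum_(k < N.+1) S j k *: (fstar j k + Phistar j k)
      - (j == ord0)%:R *: (fhat0L + PhiD0L)
      + (j == ord_max)%:R *: (fhatNR + PhiDNR) = 0
    <->
    mass J xi j *: udot j = Gamma j (j%:Z - 1) - Gamma j (j%:Z + 1).
Proof.
move=> S Gamma j; rewrite /Gamma staggered_flux_prev staggered_flux_next.
have S_skew l m : S l m = - S m l.
  by have /matrixP/(_ m l) := Smx_skew N_ge1 xi_lgl; rewrite !mxE.
have S_row := Smx_row_sum xi_lgl.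
(* The values of the cumulative flux at the outer interfaces are zero, so the
   surface terms can be added to it uniformly in [j]. *)
set gL := fhat0L + _; set gR := fhatNR + _.
set flux := cumulative_flux S fstar (fun j => Philoc (u j)) Phijump.
have -> : (if j == ord0 then gL else flux j (fun l => (l < j)%N)) =
    (j == ord0)%:R *: gL + flux j (fun l => (l < j)%N).
  have [->|_] := eqVneq j ord0; last by rewrite scale0r add0r.
  by rewrite scale1r /flux cumulative_flux_first ?addr0 // Phijump_r subrr.
have -> : (if j == ord_max then gR else flux j (fun l => (l <= j)%N)) =
    (j == ord_max)%:R *: gR + flux j (fun l => (l <= j)%N).
  have [->|_] := eqVneq j ord_max; last by rewrite scale0r add0r.
  rewrite scale1r /flux.
  by rewrite (cumulative_flux_last _ S_skew S_row fstar_sym Phijump_r) addr0.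
have -> : \sum_k S j k *: (fstar j k + Phistar j k) =
    flux j (fun l => (l <= j)%N) - flux j (fun l => (l < j)%N).
  rewrite /flux cumulative_flux_step.
  by apply: eq_bigr => k _; rewrite Phistar_split.
set a := mass J xi j *: _; set b := _ *: gL; set c := _ *: gR.
set d := flux j _; set e := flux j _.
have -> : a + (d - e) - b + c = a - (b + e - (c + d)).
  apply/matrixP => i k; rewrite !mxE; ring.
by split=> [/eqP|->]; rewrite ?subr_eq0 ?subrr // => /eqP.
Qed.
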